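(* Let $(\mathsf{u}_t)_{t\in\mathbb{R}}$ be a continuous path of pairwise ultraparallel spacelike vectors in $\mathsf{V}$. Let $(p_t)_{t\in\mathbb{R}}$ be a regular curve in $\mathsf{E}$ admitting the crooked foliation $\{\mathcal{C}(p_t,\mathsf{u}_t)\}_{t\in\mathbb{R}}$ (that is, such that $\{\mathcal{C}(p_t,\mathsf{u}_t)\}_{t\in\mathbb{R}}$ is a crooked foliation). Then for every $t\in\mathbb{R}$, $\dot p_t\in\mathsf{V}_{\neq 0}(\mathsf{u}_t)$.
   Context: $\mathsf{V}=\mathbb{R}^3$ with scalar product of signature $(2,1)$ given by $\mathsf{x}\cdot\mathsf{y}=x_1y_1+x_2y_2-x_3y_3$; $\mathsf{E}$ is the affine space modeled on $\mathsf{V}$. A nonzero vector $\mathsf{v}$ is timelike, null, or spacelike if $\mathsf{v}\cdot\mathsf{v}$ is $<0$, $=0$, $>0$ respectively. $\mathsf{v}^\perp$ is the set of vectors orthogonal to $\mathsf{v}$ for this product. Null frame: for $\mathsf{u}$ spacelike, $\mathsf{u}^-,\mathsf{u}^+$ are the null vectors with third coordinate $1$ such that $\mathsf{u}^\perp=\langle \mathsf{u}^-,\mathsf{u}^+\rangle$ and $\det[\mathsf{u}\ \mathsf{u}^-\ \mathsf{u}^+]>0$. Crooked plane $\mathcal{C}(p,\mathsf{u})$ with vertex $p\in\mathsf{E}$ and (spacelike) director $\mathsf{u}$: the union of the stem $p+\{\mathsf{x}\in\mathsf{u}^\perp:\mathsf{x}\cdot\mathsf{x}\le 0\}$ and the two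 wings $p+\{\mathsf{x}\in(\mathsf{u}^+)^\perp:\mathsf{x}^+=\mathsf{u}^+\}$ and $p+\{\mathsf{x}\in(\mathsf{u}^-)^\perp:\mathsf{x}^+=\mathsf{u}^-\}$, where in the wings $\mathsf{x}$ is spacelike, so that $\mathsf{x}^+$ is defined by the null frame of $\mathsf{x}$. Quadrant: for $\mathsf{u}$ spacelike, $\mathsf{V}_{\neq 0}(\mathsf{u})=\{a\mathsf{u}^- - b\mathsf{u}^+ : a,b\ge 0\}\setminus\{0\}$, a quadrant in $\mathsf{u}^\perp$. Two spacelike vectors $\mathsf{u}_1,\mathsf{u}_2$ are ultraparallel if $\mathsf{u}_1^\perp\cap\mathsf{u}_2^\perp$ is spacelike (a line spanned by a spacelike vector). A regular curve is a smooth parametrized curve with nowhere zero tangent vector; $\dot p_t$ denotes the derivative of $p_t$ with respect to $t$. A crooked foliation is a path $\{\mathcal{C}(p_t,\mathsf{u}_t)\}_{t\in\mathbb{R}}$ of pairwise disjoint crooked planes, where $(\mathsf{u}_t)$ is a continuous curve of spacelike vectors in $\mathsf{V}$ and $(p_t)$ is a regular curve of points in $\mathsf{E}$.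
   Formalization: Since C(p,-u)=C(p,u) but V_{≠0}(-u)=-V_{≠0}(u), the claim as worded fails for one of u, -u. What is proved: there is a sign e in {1,-1}, depending only on the path (u_t), such that the derivative of p_t lies in V_{≠0}(e u_t) for every t and every such curve p. *)

(* Defs.v *)
From HB Require Import structures.
From mathcomp Require Import all_boot all_order all_algebra.
From mathcomp Require Import all_classical all_reals all_analysis.
From mathcomp Require Import ring lra.

Set Implicit Arguments.
Unset Strict Implicit.
Unset Printing Implicit Defensive.

Import Order.TTheory GRing.Theory Num.Theory.
Import numFieldNormedType.Exports.

Local Open Scope classical_set_scope.
Local Open Scope ring_scope.

Section Minkowski.
Context {R : realType}.

(* The affine space E is identified with V by the choice of an origin, so both
   points and vectors have type 'rV[R]_3. *)
Implicit Types u v w x y p : 'rV[R]_3.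

Definition mdot x y : R :=
  x ord0 0 * y ord0 0 + x ord0 1 * y ord0 1 - x ord0 2 * y ord0 2.

Definition timelike v : Prop := v <> 0 /\ mdot v v < 0.
Definition null v : Prop := v <> 0 /\ mdot v v = 0.
Definition spacelike v : Prop := v <> 0 /\ 0 < mdot v v.

Definition perp v : set 'rV[R]_3 := [set x | mdot x v = 0].

(* Vectors are rows here; transposing the matrix of columns does not change
   its determinant. *)
Definition det3 u v w : R := \det (\matrix_(i < 3) [:: u; v; w]`_i).

Definition vec3 (a b c : R) : 'rV[R]_3 := \row_(i < 3) [:: a; b; c]`_i.

Lemma vec3E a b c :
  (vec3 a b c ord0 0 = a) * (vec3 a b c ord0 1 = b) * (vec3 a b c ord0 2 = c).
Proof. by rewrite !mxE. Qed.

Lemma eq_vec3 x y : x ord0 0 = y ord0 0 -> x ord0 1 = y ord0 1 ->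
  x ord0 2 = y ord0 2 -> x = y.
Proof.
move=> h0 h1 h2; apply/rowP => -[[|[|[|//]]] hi].
- by rewrite (_ : Ordinal hi = 0) //; exact: val_inj.
- by rewrite (_ : Ordinal hi = 1) //; exact: val_inj.
- by rewrite (_ : Ordinal hi = 2) //; exact: val_inj.
Qed.

Lemma det3E u v w : det3 u v w =
  u ord0 0 * (v ord0 1 * w ord0 2 - v ord0 2 * w ord0 1)
  - u ord0 1 * (v ord0 0 * w ord0 2 - v ord0 2 * w ord0 0)
  + u ord0 2 * (v ord0 0 * w ord0 1 - v ord0 1 * w ord0 0).
Proof.
rewrite /det3 (expand_det_row _ 0) !big_ord_recl big_ord0 /cofactor.
rewrite !(expand_det_row _ 0) !big_ord_recl !big_ord0 /cofactor !det_mx11 !mxE /=.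
have [g e] : exists g : 'rV[R]_3 -> nat -> R,
    forall x (k : 'I_3), x ord0 k = g x (nat_of_ord k).
  by exists (fun x n => x ord0 (inord n)) => x k; rewrite inord_val.
by rewrite !e /= /bump /= !expr0 ?exprS ?expr0; ring.
Qed.

Lemma mem_span2 v w x : (x \in <<[:: v; w]>>%VS) <->
  exists a b : R, x = a *: v + b *: w.
Proof.
rewrite span_cons span_seq1; split.
  move=> /memv_addP[y /vlineP[a ->] [z /vlineP[b ->] ->]]; by exists a, b.
move=> [a [b ->]]; apply: memv_add; apply: memvZ; exact: memv_line.
Qed.

Definition is_null_frame u (f : 'rV[R]_3 * 'rV[R]_3) : Prop :=
  [/\ null f.1 /\ f.1 ord0 2 = 1,
      null f.2 /\ f.2 ord0 2 = 1,
      perp u = [set` <<[:: f.1; f.2]>>%VS]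
    & 0 < det3 u f.1 f.2].

Definition null_frame_expl u : 'rV[R]_3 * 'rV[R]_3 :=
  let a := u ord0 0 in let b := u ord0 1 in let c := u ord0 2 in
  let s := Num.sqrt (mdot u u) in let d := a ^+ 2 + b ^+ 2 in
  (vec3 ((c * a - s * b) / d) ((c * b + s * a) / d) 1,
   vec3 ((c * a + s * b) / d) ((c * b - s * a) / d) 1).

Lemma null_frame_uniq u f :
  spacelike u -> is_null_frame u f -> f = null_frame_expl u.
Proof.
move=> [_ us] [[[_ n1] z1] [[_ n2] z2] pu]; rewrite det3E => du.
have p1 : perp u f.1.
  by rewrite pu /= mem_span2; exists 1, 0; rewrite scale1r scale0r addr0.
have p2 : perp u f.2.
  by rewrite pu /= mem_span2; exists 0, 1; rewrite scale1r scale0r add0r.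
move: n1 n2 du p1 p2; rewrite /perp/= /mdot z1 z2 /null_frame_expl.
set s := Num.sqrt _.
have s0 : 0 < s by rewrite sqrtr_gt0.
have ss : s ^+ 2 = mdot u u by rewrite sqr_sqrtr// ltW.
move: ss us; rewrite /mdot.
case: f z1 z2 pu => f1 f2 /= z1 z2 _.
move: z1 z2.
set a := u ord0 0; set b := u ord0 1; set c := u ord0 2.
set x := f1 ord0 0; set y := f1 ord0 1.
set x' := f2 ord0 0; set y' := f2 ord0 1.
move=> z1 z2 ss us n1 n2 du p1 p2.
pose k := a * y - b * x; pose k' := a * y' - b * x'.
have D0 : 0 < a ^+ 2 + b ^+ 2 by nra.
have q1 : a * x + b * y = c by lra.
have q2 : a * x' + b * y' = c by lra.
have r1 : x * x + y * y = 1 by lra.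
have r2 : x' * x' + y' * y' = 1 by lra.
have Dx : (a ^+ 2 + b ^+ 2) * x = c * a - k * b.
  by rewrite -q1 /k; ring.
have Dy : (a ^+ 2 + b ^+ 2) * y = c * b + k * a.
  by rewrite -q1 /k; ring.
have Dx' : (a ^+ 2 + b ^+ 2) * x' = c * a - k' * b.
  by rewrite -q2 /k'; ring.
have Dy' : (a ^+ 2 + b ^+ 2) * y' = c * b + k' * a.
  by rewrite -q2 /k'; ring.
have kk : k ^+ 2 = s ^+ 2.
  rewrite ss -q1.
  have -> : a * a + b * b = (a ^+ 2 + b ^+ 2) * (x * x + y * y).
    by rewrite r1; ring.
  by rewrite /k; ring.
have kk' : k' ^+ 2 = s ^+ 2.
  rewrite ss -q2.
  have -> : a * a + b * b = (a ^+ 2 + b ^+ 2) * (x' * x' + y' * y').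
    by rewrite r2; ring.
  by rewrite /k'; ring.
have kd : (a ^+ 2 + b ^+ 2) * (a * (y * 1 - 1 * y') - b * (x * 1 - 1 * x')
   + c * (x * y' - y * x')) = (k - k') * s ^+ 2.
  apply: (@mulfI _ (a ^+ 2 + b ^+ 2)); first exact: lt0r_neq0.
  rewrite ss.
  have -> : (a ^+ 2 + b ^+ 2) * ((a ^+ 2 + b ^+ 2) *
    (a * (y * 1 - 1 * y') - b * (x * 1 - 1 * x') + c * (x * y' - y * x'))) =
    (a ^+ 2 + b ^+ 2) * (a * ((a ^+ 2 + b ^+ 2) * y - (a ^+ 2 + b ^+ 2) * y')
     - b * ((a ^+ 2 + b ^+ 2) * x - (a ^+ 2 + b ^+ 2) * x'))
    + c * (((a ^+ 2 + b ^+ 2) * x) * ((a ^+ 2 + b ^+ 2) * y')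
      - ((a ^+ 2 + b ^+ 2) * y) * ((a ^+ 2 + b ^+ 2) * x')) by ring.
  by rewrite Dx Dy Dx' Dy'; ring.
have kk'0 : 0 < k - k'.
  by rewrite -(@pmulr_lgt0 _ (s ^+ 2)) ?exprn_gt0// -kd mulr_gt0.
have /eqP : k ^+ 2 = s ^+ 2 by [].
have /eqP : k' ^+ 2 = s ^+ 2 by [].
rewrite !eqf_sqr => /orP[] /eqP e' /orP[] /eqP e; try by exfalso; lra.
have Dn : a ^+ 2 + b ^+ 2 != 0 by exact: lt0r_neq0.
rewrite e in Dx Dy; rewrite e' in Dx' Dy'.
congr pair; apply: eq_vec3; rewrite !vec3E //.
- by rewrite -Dx mulrAC mulfV// mul1r.
- by rewrite -Dy mulrAC mulfV// mul1r.
- have -> : c * a + s * b = c * a - - s * b by ring.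
  by rewrite -Dx' mulrAC mulfV// mul1r.
- have -> : c * b - s * a = c * b + - s * a by ring.
  by rewrite -Dy' mulrAC mulfV// mul1r.
Qed.

Lemma null_frame_explP u : spacelike u -> is_null_frame u (null_frame_expl u).
Proof.
move=> [_ us]; rewrite /null_frame_expl.
set s := Num.sqrt _.
have s0 : 0 < s by rewrite sqrtr_gt0.
have ss : s ^+ 2 = mdot u u by rewrite sqr_sqrtr// ltW.
move: ss us; rewrite /mdot.
set a := u ord0 0; set b := u ord0 1; set c := u ord0 2 => ss us.
have D0 : 0 < a ^+ 2 + b ^+ 2 by nra.
have Dn : a ^+ 2 + b ^+ 2 != 0 by exact: lt0r_neq0.
have sn : s != 0 by exact: lt0r_neq0.
have nz (x y : R) : vec3 x y 1 <> 0.
  by move=> /rowP/(_ 2); rewrite vec3E mxE => /eqP; rewrite oner_eq0.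
have cc : c ^+ 2 = a ^+ 2 + b ^+ 2 - s ^+ 2 by rewrite ss; ring.
split => /=.
- split; last by rewrite vec3E.
  split; first exact: nz.
  rewrite /mdot !vec3E.
  transitivity ((c ^+ 2 + s ^+ 2) / (a ^+ 2 + b ^+ 2) - 1); first by field.
  by rewrite cc subrK divff ?subrr.
- split; last by rewrite vec3E.
  split; first exact: nz.
  rewrite /mdot !vec3E.
  transitivity ((c ^+ 2 + s ^+ 2) / (a ^+ 2 + b ^+ 2) - 1); first by field.
  by rewrite cc subrK divff ?subrr.
- apply/seteqP; split=> x /=.
    rewrite mem_span2 /perp/= /mdot -/a -/b -/c => xu.
    pose m := (x ord0 1 * a - x ord0 0 * b) / s.
    exists ((x ord0 2 + m) / 2), ((x ord0 2 - m) / 2).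
    apply: eq_vec3; rewrite !mxE /= /m.
    + transitivity ((x ord0 2 * c * a - (x ord0 1 * a - x ord0 0 * b) * b)
        / (a ^+ 2 + b ^+ 2)); last by field; rewrite Dn sn.
      have -> : x ord0 2 * c = x ord0 0 * a + x ord0 1 * b by lra.
      by field.
    + transitivity ((x ord0 2 * c * b + (x ord0 1 * a - x ord0 0 * b) * a)
        / (a ^+ 2 + b ^+ 2)); last by field; rewrite Dn sn.
      have -> : x ord0 2 * c = x ord0 0 * a + x ord0 1 * b by lra.
      by field.
    + by field.
  rewrite mem_span2 => -[p [q ->]]; rewrite /perp/= /mdot !mxE /= -/a -/b -/c.
  by field.
- rewrite det3E !vec3E -/a -/b -/c.
  have -> : a * ((c * b + s * a) / (a ^+ 2 + b ^+ 2) * 1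
      - 1 * ((c * b - s * a) / (a ^+ 2 + b ^+ 2)))
   - b * ((c * a - s * b) / (a ^+ 2 + b ^+ 2) * 1
      - 1 * ((c * a + s * b) / (a ^+ 2 + b ^+ 2)))
   + c * ((c * a - s * b) / (a ^+ 2 + b ^+ 2) * ((c * b - s * a) / (a ^+ 2 + b ^+ 2))
      - (c * b + s * a) / (a ^+ 2 + b ^+ 2) * ((c * a + s * b) / (a ^+ 2 + b ^+ 2)))
   = 2 * s * ((a ^+ 2 + b ^+ 2) - c ^+ 2) / (a ^+ 2 + b ^+ 2) by field.
  rewrite cc; apply: divr_gt0 => //.
  have -> : 2 * s * (a ^+ 2 + b ^+ 2 - (a ^+ 2 + b ^+ 2 - s ^+ 2)) = 2 * s ^+ 3 by ring.
  by rewrite mulr_gt0 // exprn_gt0.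
Qed.


(* The null frame (u^-, u^+); see [null_frameP] and [null_frame_uniq].  The
   value is irrelevant when u is not spacelike. *)
Definition null_frame u : 'rV[R]_3 * 'rV[R]_3 := xget (0, 0) (is_null_frame u).
Definition nminus u : 'rV[R]_3 := (null_frame u).1.
Definition nplus u : 'rV[R]_3 := (null_frame u).2.

Lemma null_frameE u : spacelike u -> null_frame u = null_frame_expl u.
Proof.
move=> us; rewrite /null_frame; case: xgetP => [f _ fu|/(_ (null_frame_expl u))].
  exact: null_frame_uniq.
by move=> []; exact: null_frame_explP.
Qed.

Lemma null_frameP u : spacelike u -> is_null_frame u (null_frame u).
Proof. by move=> us; rewrite null_frameE//; exact: null_frame_explP. Qed.

Lemma mdotNN u : mdot (- u) (- u) = mdot u u.
Proof. by rewrite /mdot !mxE; ring. Qed.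

Lemma spacelikeN u : spacelike u -> spacelike (- u).
Proof.
move=> [u0 us]; split; last by rewrite mdotNN.
by move=> /eqP; rewrite oppr_eq0 => /eqP.
Qed.

Lemma null_frameN u : spacelike u ->
  nminus (- u) = nplus u /\ nplus (- u) = nminus u.
Proof.
move=> us; rewrite /nminus /nplus !null_frameE//; last exact: spacelikeN.
rewrite /null_frame_expl /= mdotNN !mxE.
set s := Num.sqrt _; set a := u ord0 0; set b := u ord0 1; set c := u ord0 2.
by rewrite !sqrrN !mulrNN !mulrN !opprK.
Qed.

Definition stem u : set 'rV[R]_3 := [set x | perp u x /\ mdot x x <= 0].

Definition wing_plus u : set 'rV[R]_3 :=
  [set x | [/\ perp (nplus u) x, spacelike x & nplus x = nplus u]].

Definition wing_minus u : set 'rV[R]_3 :=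
  [set x | [/\ perp (nminus u) x, spacelike x & nplus x = nminus u]].

Definition crooked_plane p u : set 'rV[R]_3 :=
  [set p + x | x in stem u `|` wing_plus u `|` wing_minus u].

(* A crooked plane determines its director only up to sign, whereas the quadrant
   of - u is the opposite of the quadrant of u: a statement placing the velocity
   of a crooked foliation in the quadrants of its directors must first orient
   the director path. *)
Lemma crooked_planeN p u : spacelike u ->
  crooked_plane p (- u) = crooked_plane p u.
Proof.
move=> us; have [em ep] := null_frameN us.
rewrite /crooked_plane /wing_plus /wing_minus em ep -!setUA [X in _ `|` X]setUC.
congr (image (_ `|` _) _); apply/seteqP; split=> x /=;
  rewrite /stem /perp /= /mdot !mxE !mulrN => -[h1 h2]; split => //; lra.
Qed.

Definition quadrant u : set 'rV[R]_3 :=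
  [set v | v <> 0 /\ exists a b : R,
    [/\ 0 <= a, 0 <= b & v = a *: nminus u - b *: nplus u]].

Definition ultraparallel u1 u2 : Prop :=
  [/\ spacelike u1, spacelike u2 &
      exists2 w, spacelike w & perp u1 `&` perp u2 = [set` <[w]>%VS]].

Definition smooth_curve (p : R -> 'rV[R]_3) : Prop :=
  forall (n : nat) (t : R), derivable (p^`(n))%classic t 1.

Definition regular_curve (p : R -> 'rV[R]_3) : Prop :=
  smooth_curve p /\ forall t, (p^`())%classic t <> 0.

Definition crooked_foliation (p u : R -> 'rV[R]_3) : Prop :=
  [/\ continuous u, forall t, spacelike (u t), regular_curve p &
      trivIset setT (fun t => crooked_plane (p t) (u t))].

End Minkowski.

(* Main.v *)
(* If the crooked planes C(p1, u1) and C(p2, u2) are disjoint, then already the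
   disjointness of their wings gives det(p2 - p1, n, m) >= 0 for every null end
   n of u1 and m of u2.  Along a foliation, divide by s - t and let s decrease
   to t.  The opposite ends n = u_t^-, m = u_s^+ and n = u_t^+, m = u_s^- force
   p' to lie in the plane of u_t^- and u_t^+.  For equal ends, n and m come
   together and the leading term of the determinant has the sign of p' . n up to
   the direction in which the null end rotates.  Ultraparallelism puts u_s^- and
   u_s^+ on the same side of u_t^perp, so the two ends rotate in opposite
   directions; by connectedness of {t < s} that side is the same for all
   t < s, which provides the sign e. *)
Require Import Defs.
From mathcomp Require Import all_boot all_order all_algebra.
From mathcomp Require Import all_classical all_reals all_analysis.
From mathcomp Require Import ring lra.
Import Order.TTheory.
Import GRing.Theory Num.Theory numFieldNormedType.Exports.
Local Open Scope classical_set_scope.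
Local Open Scope ring_scope.

Section CrookedPlanes.
Context {R : realType}.
Implicit Types d m n p u v w x : 'rV[R]_3.

(** * Null vectors on the unit circle at height one, and wings that meet *)

(** The velocity of [n] under rotation about the third axis. For null [n] at height 1 it is a unit
    spacelike vector that spans, together with [n], the plane orthogonal to [n]. *)
Definition circle_tangent n : 'rV[R]_3 := vec3 (- n ord0 1) (n ord0 0) 0.

Lemma mdotDl x v w : mdot (x + v) w = mdot x w + mdot v w.
Proof. by rewrite /mdot !mxE; ring. Qed.

Lemma mdotNl x w : mdot (- x) w = - mdot x w.
Proof. by rewrite /mdot !mxE; ring. Qed.

Lemma mdotZl (a : R) x w : mdot (a *: x) w = a * mdot x w.
Proof. by rewrite /mdot !mxE; ring. Qed.

Lemma mdotC x w : mdot x w = mdot w x.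
Proof. by rewrite /mdot; ring. Qed.

Lemma circle_coords n : null n -> n ord0 2 = 1 ->
  n ord0 0 ^+ 2 + n ord0 1 ^+ 2 = 1.
Proof. by move=> [_]; rewrite /mdot => nn z; move: nn; rewrite z; lra. Qed.

Lemma mdot_tangent x n :
  mdot x (circle_tangent n) = x ord0 1 * n ord0 0 - x ord0 0 * n ord0 1.
Proof. by rewrite /mdot !vec3E; ring. Qed.

(** Here [x] is [c *: n + s *: circle_tangent n] with [c] its height, so [mdot x x] is [s ^+ 2]. As
    [s] is positive, the square root in the explicit null frame is [s] itself, and the formula for
    [nplus x] collapses to [n]. *)
Lemma mem_wing n x : null n -> n ord0 2 = 1 -> mdot x n = 0 ->
  0 < mdot x (circle_tangent n) ->
  [/\ perp n x, spacelike x & nplus x = n].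
Proof.
move=> nn nz; rewrite mdot_tangent.
have c1 := circle_coords _ nn nz.
set s := _ - _; rewrite {1}/mdot nz mulr1 => xn s0.
have x0 : x ord0 0 = x ord0 2 * n ord0 0 - s * n ord0 1.
  transitivity (x ord0 0 * (n ord0 0 ^+ 2 + n ord0 1 ^+ 2)).
    by rewrite c1 mulr1.
  by have -> : x ord0 2 = x ord0 0 * n ord0 0 + x ord0 1 * n ord0 1;
    [lra|rewrite /s; ring].
have x1 : x ord0 1 = x ord0 2 * n ord0 1 + s * n ord0 0.
  transitivity (x ord0 1 * (n ord0 0 ^+ 2 + n ord0 1 ^+ 2)).
    by rewrite c1 mulr1.
  by have -> : x ord0 2 = x ord0 0 * n ord0 0 + x ord0 1 * n ord0 1;
    [lra|rewrite /s; ring].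
move: x0 x1; move: s s0 xn => s s0 xn; set c := x ord0 2 => x0 x1.
have xx : mdot x x = s ^+ 2.
  rewrite /mdot x0 x1 -/c.
  transitivity ((c ^+ 2 + s ^+ 2) * (n ord0 0 ^+ 2 + n ord0 1 ^+ 2) - c ^+ 2).
    by ring.
  by rewrite c1; ring.
have xs : spacelike x.
  split; last by rewrite xx exprn_gt0.
  move=> x00; move: xx; rewrite x00 /mdot !mxE.
  have := exprn_gt0 2 s0; lra.
split=> //; first by rewrite /perp /= /mdot nz mulr1.
rewrite /nplus null_frameE// /null_frame_expl /= xx sqrtr_sqr gtr0_norm//.
have -> : x ord0 0 ^+ 2 + x ord0 1 ^+ 2 = c ^+ 2 + s ^+ 2.
  rewrite x0 x1.
  transitivity ((c ^+ 2 + s ^+ 2) * (n ord0 0 ^+ 2 + n ord0 1 ^+ 2)).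
    by ring.
  by rewrite c1; ring.
have D0 : c ^+ 2 + s ^+ 2 != 0.
  by apply: lt0r_neq0; have := exprn_gt0 2 s0; have := sqr_ge0 c; lra.
by apply: eq_vec3; rewrite !vec3E ?nz// x0 x1 -/c; field.
Qed.

(** Up to the factor -2, the product is the squared Euclidean distance between two points of the
    unit circle. *)
Lemma null_mdot_lt0 n m : null n -> n ord0 2 = 1 -> null m -> m ord0 2 = 1 ->
  n <> m -> mdot n m < 0.
Proof.
move=> nn nz mn mz nm.
have n1 := circle_coords _ nn nz; have m1 := circle_coords _ mn mz.
have E : - 2 * mdot n m =
    (n ord0 0 - m ord0 0) ^+ 2 + (n ord0 1 - m ord0 1) ^+ 2.
  transitivity (n ord0 0 ^+ 2 + n ord0 1 ^+ 2 +
    (m ord0 0 ^+ 2 + m ord0 1 ^+ 2) - 2 * (1 + mdot n m)).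
    by rewrite n1 m1; ring.
  by rewrite /mdot nz mz; ring.
rewrite -(nmulr_rgt0 (x := - 2)) ?oppr_lt0// E lt_def addr_ge0 ?sqr_ge0// andbT.
rewrite paddr_eq0 ?sqr_ge0// !sqrf_eq0 !subr_eq0; apply/negP.
by move=> /andP[/eqP e0 /eqP e1]; apply: nm; apply: eq_vec3; rewrite ?nz.
Qed.

(* The null planes orthogonal to n and m meet in a line directed by the Lorentz
   cross product w of n and m; the two wings cut opposite rays on it, and d . w
   is a determinant. *)
Lemma wings_meet d n m : null n -> n ord0 2 = 1 -> null m -> m ord0 2 = 1 ->
  det3 d n m < 0 ->
  exists x, [/\ perp n x, spacelike x & nplus x = n] /\
    [/\ perp m (x - d), spacelike (x - d) & nplus (x - d) = m].
Proof.
move=> nn nz mn mz dd.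
have n1 := circle_coords _ nn nz; have m1 := circle_coords _ mn mz.
(* If theta is the angle from [n] to [m], then [k] is 1 - cos theta, which equals [- mdot n m], and
   [c] is sin theta. *)
pose k := 1 - n ord0 0 * m ord0 0 - n ord0 1 * m ord0 1.
pose c := n ord0 0 * m ord0 1 - n ord0 1 * m ord0 0.
have k_gt0 : 0 < k.
  have : n <> m by move=> e; move: dd; rewrite e det3E; lra.
  by move=> /(null_mdot_lt0 _ _ nn nz mn mz); rewrite /mdot nz mz /k; lra.
have kn : k != 0 by exact: lt0r_neq0.
have cc : c ^+ 2 = 1 - (1 - k) ^+ 2.
  transitivity ((n ord0 0 ^+ 2 + n ord0 1 ^+ 2) *
    (m ord0 0 ^+ 2 + m ord0 1 ^+ 2) - (1 - k) ^+ 2).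
    by rewrite /k /c; ring.
  by rewrite n1 m1; ring.
have dE : det3 d n m = k * mdot d (circle_tangent m) - mdot d m * c.
  apply/eqP; rewrite -subr_eq0; apply/eqP.
  transitivity ((d ord0 0 * n ord0 1 - d ord0 1 * n ord0 0) *
    (1 - (m ord0 0 ^+ 2 + m ord0 1 ^+ 2))).
    by rewrite det3E mdot_tangent /mdot nz mz /k /c; ring.
  by rewrite m1; ring.
(* The choice of [b] makes [x - d] orthogonal to [m]. The tangent coefficients of [x] and [x - d]
   are then [s] and [- s - det3 d n m / k]; this [s] makes them equal, hence both positive. *)
pose s := - det3 d n m / (2 * k).
have s0 : 0 < s by rewrite divr_gt0 ?mulr_gt0 ?oppr_gt0.
pose b := s / k * c - mdot d m / k.
exists (s *: circle_tangent n + b *: n); split; apply: mem_wing => //.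
- rewrite mdotDl !mdotZl /mdot !vec3E nz.
  transitivity (b * (n ord0 0 ^+ 2 + n ord0 1 ^+ 2 - 1)); first by ring.
  by rewrite n1; ring.
- rewrite mdotDl !mdotZl !mdot_tangent !vec3E.
  suff -> : s * (n ord0 0 * n ord0 0 - - n ord0 1 * n ord0 1) +
    b * (n ord0 1 * n ord0 0 - n ord0 0 * n ord0 1) =
    s * (n ord0 0 ^+ 2 + n ord0 1 ^+ 2) by rewrite n1 mulr1.
  by ring.
- rewrite !mdotDl mdotNl !mdotZl.
  have -> : mdot (circle_tangent n) m = c by rewrite mdotC mdot_tangent /c; ring.
  have -> : mdot n m = - k by rewrite /mdot nz mz /k; ring.
  by rewrite /b; field.
- rewrite !mdotDl mdotNl !mdotZl.
  suff -> : s * mdot (circle_tangent n) (circle_tangent m) +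
    b * mdot n (circle_tangent m) - mdot d (circle_tangent m) = s by [].
  have -> : mdot (circle_tangent n) (circle_tangent m) = 1 - k.
    by rewrite mdot_tangent !vec3E /k; ring.
  have -> : mdot n (circle_tangent m) = - c.
    by rewrite mdot_tangent /c; ring.
  transitivity (s * (1 - k) - s * c ^+ 2 / k -
    (k * mdot d (circle_tangent m) - mdot d m * c) / k).
    by rewrite /b; field.
  by rewrite cc -dE /s; field.
Qed.

(** * Disjoint crooked planes and determinants of null ends *)

Lemma nminus_null u : spacelike u -> null (nminus u) /\ nminus u ord0 2 = 1.
Proof. by move=> /null_frameP[]. Qed.

Lemma nplus_null u : spacelike u -> null (nplus u) /\ nplus u ord0 2 = 1.
Proof. by move=> /null_frameP[]. Qed.

Lemma null_frame_mdot u : spacelike u -> mdot (nminus u) (nplus u) < 0.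
Proof.
move=> us; have [nn nz] := nminus_null u us; have [mn mz] := nplus_null u us.
apply: null_mdot_lt0 => // e; have [_ _ _] := null_frameP us.
by rewrite -/(nminus u) -/(nplus u) e det3E; lra.
Qed.

Lemma nminus_perp u : spacelike u -> mdot (nminus u) u = 0.
Proof.
move=> /null_frameP[_ _ pu _]; suff : perp u (nminus u) by [].
by rewrite pu /= mem_span2; exists 1, 0; rewrite scale1r scale0r addr0.
Qed.

Lemma nplus_perp u : spacelike u -> mdot (nplus u) u = 0.
Proof.
move=> /null_frameP[_ _ pu _]; suff : perp u (nplus u) by [].
by rewrite pu /= mem_span2; exists 0, 1; rewrite scale1r scale0r add0r.
Qed.

Lemma crooked_wing p u n x : n = nminus u \/ n = nplus u ->
  [/\ perp n x, spacelike x & nplus x = n] -> crooked_plane p u (p + x).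
Proof. by move=> [->|->] h; exists x => //; [right|left; right]. Qed.

Lemma crooked_disjoint_det p1 p2 u1 u2 n m :
  spacelike u1 -> spacelike u2 ->
  crooked_plane p1 u1 `&` crooked_plane p2 u2 = set0 ->
  n = nminus u1 \/ n = nplus u1 -> m = nminus u2 \/ m = nplus u2 ->
  0 <= det3 (p2 - p1) n m.
Proof.
move=> us1 us2 dis hn hm; rewrite leNgt; apply/negP => dd.
have [nn nz] : null n /\ n ord0 2 = 1.
  by case: hn => ->; [exact: nminus_null|exact: nplus_null].
have [mn mz] : null m /\ m ord0 2 = 1.
  by case: hm => ->; [exact: nminus_null|exact: nplus_null].
have [x [xn xm]] := wings_meet _ _ _ nn nz mn mz dd.
suff : (crooked_plane p1 u1 `&` crooked_plane p2 u2) (p1 + x) by rewrite dis.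
split; first exact: crooked_wing hn xn.
rewrite (_ : p1 + x = p2 + (x - (p2 - p1))); first exact: crooked_wing hm xm.
by rewrite opprB addrCA [p2 + _]addrC subrK addrC.
Qed.

(* The left-hand side is -(1 + q)^2 / p^2 times
   sigma * det3 d n m * mdot u m, with p = m . (tangent at n). *)
Lemma det_tangent_le0 (sigma : R) d n m u
    (p := mdot m (circle_tangent n))
    (q := n ord0 0 * m ord0 0 + n ord0 1 * m ord0 1) :
  null n -> n ord0 2 = 1 -> null m -> m ord0 2 = 1 -> mdot n u = 0 ->
  0 <= det3 d n m -> 0 < sigma * mdot u m ->
  sigma * ((1 + q) * mdot d n + p * mdot d (circle_tangent n)) *
    (mdot u (circle_tangent n) * (1 + q) - p * u ord0 2) <= 0.
Proof.
move=> nn nz mn mz un dd um.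
have n1 := circle_coords _ nn nz; have m1 := circle_coords _ mn mz.
(* [p] and [q] are the sine and cosine of the angle from [n] to [m]. *)
have pq : p ^+ 2 = (1 + q) * (1 - q).
  transitivity ((n ord0 0 ^+ 2 + n ord0 1 ^+ 2) *
    (m ord0 0 ^+ 2 + m ord0 1 ^+ 2) - q ^+ 2).
    by rewrite /p /q mdot_tangent; ring.
  by rewrite n1 m1; ring.
have m0E : m ord0 0 = q * n ord0 0 - p * n ord0 1.
  transitivity (m ord0 0 * (n ord0 0 ^+ 2 + n ord0 1 ^+ 2)).
    by rewrite n1 mulr1.
  by rewrite /p /q mdot_tangent; ring.
have m1E : m ord0 1 = q * n ord0 1 + p * n ord0 0.
  transitivity (m ord0 1 * (n ord0 0 ^+ 2 + n ord0 1 ^+ 2)).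
    by rewrite n1 mulr1.
  by rewrite /p /q mdot_tangent; ring.
have u2E : u ord0 2 = n ord0 0 * u ord0 0 + n ord0 1 * u ord0 1.
  by move: un; rewrite /mdot nz; lra.
have dE : det3 d n m = - p * mdot d n - (1 - q) * mdot d (circle_tangent n).
  rewrite det3E mdot_tangent {1}/mdot m0E m1E nz mz.
  transitivity (- p * (d ord0 0 * n ord0 0 + d ord0 1 * n ord0 1 -
      d ord0 2 * (n ord0 0 ^+ 2 + n ord0 1 ^+ 2))
    - (1 - q) * (d ord0 1 * n ord0 0 - d ord0 0 * n ord0 1)).
    by ring.
  by rewrite n1; ring.
have uE : mdot u m = p * mdot u (circle_tangent n) - (1 - q) * u ord0 2.
  rewrite mdot_tangent {1}/mdot m0E m1E mz u2E.
  by ring.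
(* For [p = 0], either [m] is antipodal to [n] on the circle and the left-hand side vanishes, or [m]
   has the coordinates of [n], which contradicts [um]. *)
have [p0|p0] := eqVneq p 0.
  have /eqP := pq; rewrite p0 expr0n /= eq_sym mulf_eq0 => /orP[] /eqP q0.
    by rewrite q0 !(mul0r, mulr0, addr0, subr0).
  by move: um; rewrite uE p0 q0 !(mul0r, subr0, mulr0) ltxx.
have p2 : 0 < p ^+ 2 by rewrite exprn_even_gt0.
rewrite -(pmulr_rle0 _ p2).
set X := (X in X <= 0).
(* By [pq], one factor [p] turns the bracket in [d] into [- (1 + q) * det3 d n m], and the other
   turns the bracket in [u] into [(1 + q) * mdot u m]. *)
have -> : X = - ((1 + q) ^+ 2 * (det3 d n m * (sigma * mdot u m))).
  rewrite dE uE /X.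
  transitivity (sigma * ((1 + q) * (p * mdot d n) + p ^+ 2 *
    mdot d (circle_tangent n)) * ((1 + q) * (p * mdot u (circle_tangent n)) -
    p ^+ 2 * u ord0 2)); first by ring.
  by rewrite pq; ring.
by rewrite oppr_le0 mulr_ge0 ?sqr_ge0// mulr_ge0// ltW.
Qed.

(** * Ultraparallel directors *)

(* A nonnegative combination of the null frame of u2 lies in the causal cone,
   hence cannot lie on the spacelike line u1^perp /\ u2^perp. *)
Lemma ultraparallel_comb u1 u2 (a b : R) : ultraparallel u1 u2 ->
  0 <= a -> 0 <= b -> 0 < a + b ->
  mdot u1 (a *: nminus u2 + b *: nplus u2) <> 0.
Proof.
move=> [us1 us2 [w [w0 ww] wE]] a0 b0 ab h.
have [[[n0 nn] nz] [[m0 mm] mz] _ _] := null_frameP us2.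
rewrite -/(nminus u2) -/(nplus u2) in n0 nn nz m0 mm mz.
set x := _ + _ in h.
have : (perp u1 `&` perp u2) x.
  split; first by rewrite /perp/= mdotC.
  by rewrite /perp/= /x mdotDl !mdotZl nminus_perp// nplus_perp// !mulr0 addr0.
rewrite wE /= => /vlineP[k xk].
have x2 : x ord0 2 = a + b by rewrite !mxE nz mz !mulr1.
have k0 : k != 0.
  by apply/eqP => k0; move: x2; rewrite xk k0 scale0r mxE; lra.
have : 0 < mdot x x.
  by rewrite xk mdotZl mdotC mdotZl mulrA -expr2 mulr_gt0// exprn_even_gt0.
have -> : mdot x x = a ^+ 2 * mdot (nminus u2) (nminus u2)
   + b ^+ 2 * mdot (nplus u2) (nplus u2) +
   2 * (a * b * mdot (nminus u2) (nplus u2)).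
  by rewrite /x /mdot !mxE; ring.
have := circle_coords _ (conj n0 nn) nz; have := circle_coords _ (conj m0 mm) mz.
rewrite nn mm !mulr0 !add0r pmulr_rgt0// => e1 e2.
apply/negP; rewrite -leNgt mulr_ge0_le0 ?mulr_ge0//.
rewrite /mdot nz mz.
have := sqr_ge0 (nminus u2 ord0 0 - nplus u2 ord0 0).
have := sqr_ge0 (nminus u2 ord0 1 - nplus u2 ord0 1).
by nra.
Qed.

(** If [A] and [B] had opposite signs, the weights [|B|] and [|A|] would give a combination
    orthogonal to [u1], against [ultraparallel_comb]. The weights (1, 0) and (0, 1) rule out zero
    values. *)
Lemma ultraparallel_same_side u1 u2 : ultraparallel u1 u2 ->
  0 < mdot u1 (nminus u2) * mdot u1 (nplus u2).
Proof.
move=> h; set A := mdot u1 _; set B := mdot u1 _.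
have comb a b : mdot u1 (a *: nminus u2 + b *: nplus u2) = a * A + b * B.
  by rewrite mdotC mdotDl !mdotZl mdotC [X in _ + _ * X]mdotC.
have A0 : A <> 0.
  have := ultraparallel_comb _ _ 1 0 h ler01 (lexx 0).
  by rewrite comb mul1r mul0r !addr0; apply.
have B0 : B <> 0.
  have := ultraparallel_comb _ _ 0 1 h (lexx 0) ler01.
  by rewrite comb mul1r mul0r !add0r; apply.
rewrite ltNge; apply/negP => AB.
have /eqP B0' := B0.
have := ultraparallel_comb _ _ `|B| `|A| h (normr_ge0 _) (normr_ge0 _).
rewrite comb ltr_pwDl ?normr_gt0// => /(_ isT); apply.
have [a|a|/esym//] := ltgtP 0 A; have [b|b|/esym//] := ltgtP 0 B.
- by move: AB; rewrite leNgt mulr_gt0.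
- by rewrite (gtr0_norm a) (ltr0_norm b); ring.
- by rewrite (ltr0_norm a) (gtr0_norm b); ring.
- by move: AB; rewrite leNgt nmulr_rgt0// b.
Qed.

(** * Signs read off the explicit null frame *)

(** In the explicit frame the determinant is a positive multiple of [mdot v u]. *)
Lemma det_null_frame u v : spacelike u ->
  det3 v (nminus u) (nplus u) = 0 ->
  exists a b, v = a *: nminus u + b *: nplus u.
Proof.
move=> us dv; apply/mem_span2; have [_ _ pu _] := null_frameP us.
rewrite -/(nminus u) -/(nplus u) in pu.
suff : perp u v by rewrite pu.
have sE := sqr_sqrtr (ltW us.2).
have s0 : 0 < Num.sqrt (mdot u u) by rewrite sqrtr_gt0 us.2.
move: dv; rewrite /nminus /nplus null_frameE// /null_frame_expl /=.
rewrite det3E !vec3E /perp/=; move: sE s0; set s := Num.sqrt _.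
rewrite /mdot; set a := u ord0 0; set b := u ord0 1; set c := u ord0 2.
move=> sE s0; set X := (X in X = 0).
have D0 : a ^+ 2 + b ^+ 2 != 0.
  by apply: lt0r_neq0; have := exprn_gt0 2 s0; have := sqr_ge0 c; nra.
have -> : X = 2 * s / (a ^+ 2 + b ^+ 2) *
  (v ord0 0 * a + v ord0 1 * b - v ord0 2 * c) by rewrite /X; field.
by move=> /eqP; rewrite mulf_eq0 gt_eqF ?divr_gt0 ?mulr_gt0//=;
  [move=> /eqP|rewrite lt_def D0 addr_ge0 ?sqr_ge0].
Qed.

(** The product equals minus the square root of [mdot u u]. The opposite sign at [nplus] is what
    will give the two coordinates of the velocity opposite signs. *)
Lemma mdot_nminus_tangent u : spacelike u ->
  mdot u (circle_tangent (nminus u)) < 0.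
Proof.
move=> us; have sE := sqr_sqrtr (ltW us.2).
have s0 : 0 < Num.sqrt (mdot u u) by rewrite sqrtr_gt0 us.2.
rewrite mdot_tangent /nminus null_frameE// /null_frame_expl /= !vec3E.
move: sE s0; set s := Num.sqrt _.
rewrite /mdot; set a := u ord0 0; set b := u ord0 1; set c := u ord0 2.
move=> sE s0; have D0 : a ^+ 2 + b ^+ 2 != 0.
  by apply: lt0r_neq0; have := exprn_gt0 2 s0; have := sqr_ge0 c; nra.
by rewrite -oppr_gt0; set X := (X in 0 < X); rewrite (_ : X = s)// /X; field.
Qed.

Lemma mdot_nplus_tangent u : spacelike u ->
  0 < mdot u (circle_tangent (nplus u)).
Proof.
move=> us; have [<- _] := null_frameN us.
have := mdot_nminus_tangent _ (spacelikeN us).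
by rewrite mdotNl oppr_lt0.
Qed.

(** * Continuity of products, determinants and null frames *)

Section Convergence.
Context {T : Type} {F : set_system T} {FF : Filter F}.
Implicit Types (f g h : T -> 'rV[R]_3) (a b c : 'rV[R]_3).

(** Products, determinants and null frames are explicit in coordinates. The filter is kept general
    to serve both full and right-sided neighbourhoods. *)
Definition cvg_coords f a := forall i, f x ord0 i @[x --> F] --> a ord0 i.

Lemma cvg_coordsW f a : f x @[x --> F] --> a -> cvg_coords f a.
Proof.
move=> fa i.
apply: (@cvg_comp _ _ _ f (fun M : 'rV[R]_3 => M ord0 i) _ _ _ fa).
exact: coord_continuous.
Qed.

Lemma cvg_mdot {f g a b} : cvg_coords f a -> cvg_coords g b ->
  mdot (f x) (g x) @[x --> F] --> mdot a b.
Proof. by move=> fa gb; apply: cvgB; [apply: cvgD|]; apply: cvgM. Qed.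

Lemma cvg_det3 {f g h a b c} :
  cvg_coords f a -> cvg_coords g b -> cvg_coords h c ->
  det3 (f x) (g x) (h x) @[x --> F] --> det3 a b c.
Proof.
move=> fa gb hc; under eq_cvg do rewrite det3E.
rewrite det3E; apply: cvgD; [apply: cvgB|]; (apply: cvgM; first exact: fa);
  by apply: cvgB; apply: cvgM.
Qed.

Lemma cvg_nminus {f a} : (forall z, spacelike (f z)) -> spacelike a ->
  cvg_coords f a -> cvg_coords (nminus \o f) (nminus a).
Proof.
move=> fs sa fa.
have sq : Num.sqrt (mdot (f x) (f x)) @[x --> F] --> Num.sqrt (mdot a a).
  exact: (cvg_comp _ _ (cvg_mdot fa fa) (@sqrt_continuous _ _)).
have cd : f x ord0 0 ^+ 2 + f x ord0 1 ^+ 2 @[x --> F] -->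
    a ord0 0 ^+ 2 + a ord0 1 ^+ 2.
  by apply: cvgD; rewrite expr2; under eq_cvg do rewrite expr2; apply: cvgM.
(* A spacelike vector is never vertical, so the denominator of the explicit frame does not vanish in
   the limit. *)
have d0 : a ord0 0 ^+ 2 + a ord0 1 ^+ 2 != 0.
  apply: lt0r_neq0; have := sa.2; rewrite /mdot; have := sqr_ge0 (a ord0 2).
  by nra.
have -> : nminus \o f = fun z => (null_frame_expl (f z)).1.
  by apply/funext => z; rewrite /= /nminus null_frameE.
move=> i; rewrite /nminus null_frameE//= /null_frame_expl /=.
case: i => [[|[|[|//]]] hi].
- rewrite (_ : Ordinal hi = 0); last exact: val_inj.
  rewrite vec3E; under eq_fun do rewrite vec3E.
  by apply: cvgM; [apply: cvgB; apply: cvgM|apply: cvgV].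
- rewrite (_ : Ordinal hi = 1); last exact: val_inj.
  rewrite vec3E; under eq_fun do rewrite vec3E.
  by apply: cvgM; [apply: cvgD; apply: cvgM|apply: cvgV].
- rewrite (_ : Ordinal hi = 2); last exact: val_inj.
  rewrite vec3E; under eq_fun do rewrite vec3E.
  exact: cvg_cst.
Qed.

Lemma cvg_nplus {f a} : (forall z, spacelike (f z)) -> spacelike a ->
  cvg_coords f a -> cvg_coords (nplus \o f) (nplus a).
Proof.
move=> fs sa fa; have [<- _] := null_frameN sa.
have -> : nplus \o f = nminus \o (fun z => - f z).
  by apply/funext => z /=; rewrite (null_frameN (fs z)).1.
apply: cvg_nminus => [z||i]; [exact: spacelikeN|exact: spacelikeN|].
rewrite mxE; under eq_fun do rewrite mxE.
exact: cvgN.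
Qed.

End Convergence.

(** * Constancy of the side along the director path *)

(* The triangle s < t is connected, and s <> t forbids a sign change. *)
Lemma same_side_sign (u : R -> 'rV[R]_3) : continuous u ->
  (forall t, spacelike (u t)) ->
  (forall s t, s <> t -> ultraparallel (u s) (u t)) ->
  forall s t, s < t ->
    0 < mdot (u 0) (nminus (u 1)) * mdot (u s) (nminus (u t)).
Proof.
(* [G] follows the segment from the reference pair (0, 1) to [(s, t)]. *)
move=> uc us uu s t st; pose f a b y : R := a + (b - a) * y.
pose G y := mdot (u (f 0 s y)) (nminus (u (f 1 t y))).
have fc a b : continuous (f a b).
  move=> y; apply: cvgD; first exact: cvg_cst.
  by apply: cvgM; [exact: cvg_cst|exact: cvg_id].
have ufc a b y : u (f a b z) @[z --> y] --> u (f a b y).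
  exact: (cvg_comp _ _ (fc a b y) (uc _)).
have Gc : continuous G.
  move=> y; apply: cvg_mdot; first by apply: cvg_coordsW; exact: ufc.
  by apply: cvg_nminus => //; apply: cvg_coordsW; exact: ufc.
have G0 y : 0 <= y <= 1 -> G y <> 0.
  move=> /andP[x0 x1] Gx.
  (* The difference of the two parameters is [(1 - y) + (t - s) * y], which is positive on
     [0, 1]. *)
  have ne : f 0 s y <> f 1 t y.
    rewrite /f => e; have ts : 0 <= t - s by rewrite subr_ge0 ltW.
    have y1 : y = 1 by have := mulr_ge0 x0 ts; lra.
    by move: e; rewrite y1; lra.
  have := ultraparallel_same_side _ _ (uu _ _ ne).
  by rewrite -/(G y) Gx mul0r ltxx.
have E0 : mdot (u 0) (nminus (u 1)) = G 0.
  by rewrite /G /f !mulr0 !addr0.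
have E1 : mdot (u s) (nminus (u t)) = G 1.
  by rewrite /G /f !mulr1 !subrKC.
rewrite E0 E1 ltNge; apply/negP => GG.
have : Num.min (G 0) (G 1) <= 0 <= Num.max (G 0) (G 1).
  rewrite ge_min le_max.
  have [a|a|a] := ltgtP (G 0) 0; have [b|b|b] := ltgtP (G 1) 0 => //=.
  - by move: GG; rewrite leNgt nmulr_rgt0// b.
  - by move: GG; rewrite leNgt mulr_gt0.
move=> /(IVT ler01 (continuous_subspaceT Gc))[c].
by rewrite in_itv /= => /G0.
Qed.

(** * Passing to the limit in the difference quotient *)

Section Foliation.
Context {p u : R -> 'rV[R]_3} {t : R}.
Hypothesis fol : crooked_foliation p u.

Let v := (p^`())%classic t.
Let Q (h : R) := h^-1 *: (p (h + t) - p t).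
Let us : forall t, spacelike (u t) := let: And4 _ us _ _ := fol in us.

Lemma cvg_quotient : @cvg_coords _ (0 : R)^'+ Q v.
Proof.
case: fol => _ _ [sp _] _; apply: cvg_coordsW; apply: cvg_dnbhs_at_right.
have := sp 0 t; rewrite /derivable /= => h.
rewrite /v /derive1; apply: cvg_toP => //; move: h.
by under eq_fun do rewrite [_%:A]mulr1.
Qed.

Lemma cvg_director : @cvg_coords _ (0 : R)^'+ (fun h => u (h + t)) (u t).
Proof.
case: fol => uc _ _ _; apply: cvg_coordsW; apply: cvg_at_right_filter.
have := uc t; rewrite -[X in u X]add0r => ut.
apply: (cvg_comp (fun h : R => h + t) u _ (uc _)).
by apply: cvgD; [exact: cvg_id|exact: cvg_cst].
Qed.

Lemma quotient_det (h : R) n m : 0 < h ->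
  n = nminus (u t) \/ n = nplus (u t) ->
  m = nminus (u (h + t)) \/ m = nplus (u (h + t)) -> 0 <= det3 (Q h) n m.
Proof.
move=> h0 hn hm; have [_ _ _ /trivIsetP dis] := fol.
have -> : det3 (Q h) n m = h^-1 * det3 (p (h + t) - p t) n m.
  by rewrite !det3E !mxE; ring.
apply: mulr_ge0; first by rewrite invr_ge0 ltW.
apply: (crooked_disjoint_det _ _ _ _ _ _ (us _) (us _) _ hn hm).
by apply: dis => //; rewrite lt_eqF// ltrDr.
Qed.

(** The two mixed pairs of ends give nonnegative determinants whose limits are opposite, because
    exchanging the last two vectors changes the sign. *)
Lemma velocity_perp : det3 v (nminus (u t)) (nplus (u t)) = 0.
Proof.
have cst n : @cvg_coords _ (0 : R)^'+ (fun=> n) n by move=> i; apply: cvg_cst.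
have near_gt0 : \forall h \near (0 : R)^'+, 0 < h by exact: nbhs_right_gt.
apply/eqP; rewrite eq_le; apply/andP; split.
  rewrite -oppr_ge0.
  have -> : - det3 v (nminus (u t)) (nplus (u t)) =
    det3 v (nplus (u t)) (nminus (u t)) by rewrite !det3E; ring.
  apply: (cvgr_to_ge (cvg_det3 cvg_quotient (cst _)
    (cvg_nminus _ _ cvg_director))) => //.
  by near=> h; apply: quotient_det; [near: h|right|left].
apply: (cvgr_to_ge (cvg_det3 cvg_quotient (cst _)
  (cvg_nplus _ _ cvg_director))) => //.
by near=> h; apply: quotient_det; [near: h|left|right].
Unshelve. all: by end_near. Qed.

(** With equal ends the determinant itself tends to 0. The expression bounded in [det_tangent_le0]
    has this vanishing already divided out: as [P] tends to 0 and [1 + q] to 2, it tends to 4 times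
    the left-hand side here. *)
Lemma velocity_sign (sigma : R) (f : 'rV[R]_3 -> 'rV[R]_3) :
  f = nminus \/ f = nplus ->
  (forall s, t < s -> 0 < sigma * mdot (u t) (f (u s))) ->
  sigma * mdot v (f (u t)) * mdot (u t) (circle_tangent (f (u t))) <= 0.
Proof.
move=> hf hs; pose n := f (u t).
have fn w : spacelike w -> null (f w) /\ f w ord0 2 = 1.
  by case: hf => -> /[dup] /nminus_null ? /nplus_null.
have [nn nz] := fn _ (us t).
have un : mdot n (u t) = 0.
  by rewrite /n; case: hf => ->; [apply: nminus_perp|apply: nplus_perp].
have fc : @cvg_coords _ (0 : R)^'+ (fun h => f (u (h + t))) n.
  by rewrite /n; case: hf => ->; [apply: cvg_nminus cvg_director|
    apply: cvg_nplus cvg_director].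
have cst w : @cvg_coords _ (0 : R)^'+ (fun=> w) w by move=> i; apply: cvg_cst.
pose P h := mdot (f (u (h + t))) (circle_tangent n).
pose q h := n ord0 0 * f (u (h + t)) ord0 0 + n ord0 1 * f (u (h + t)) ord0 1.
have Pc : P h @[h --> (0 : R)^'+] --> (0 : R).
  have := cvg_mdot fc (cst (circle_tangent n)).
  have -> : mdot n (circle_tangent n) = 0 by rewrite mdot_tangent; ring.
  exact.
have qc : 1 + q h @[h --> (0 : R)^'+] --> (2 : R).
  have -> : (2 : R) = 1 + (n ord0 0 * n ord0 0 + n ord0 1 * n ord0 1).
    by rewrite -!expr2 (circle_coords _ nn nz).
  apply: cvgD; first exact: cvg_cst.
  by apply: cvgD; apply: cvgM; [exact: cvg_cst|exact: fc|exact: cvg_cst|exact: fc].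
have L : sigma * ((1 + q h) * mdot (Q h) n + P h * mdot (Q h) (circle_tangent n))
    * (mdot (u t) (circle_tangent n) * (1 + q h) - P h * u t ord0 2)
    @[h --> (0 : R)^'+] -->
    sigma * (2 * mdot v n + 0 * mdot v (circle_tangent n))
    * (mdot (u t) (circle_tangent n) * 2 - 0 * u t ord0 2).
  apply: cvgM.
    apply: cvgM; first exact: cvg_cst.
    by apply: cvgD; apply: cvgM => //; apply: cvg_mdot => //; exact: cvg_quotient.
  by apply: cvgB; apply: cvgM => //; apply: cvg_cst.
suff : sigma * (2 * mdot v n + 0 * mdot v (circle_tangent n))
    * (mdot (u t) (circle_tangent n) * 2 - 0 * u t ord0 2) <= 0.
  by rewrite /n; lra.
apply: (cvgr_to_le L); near=> h.
have h0 : 0 < h by near: h; exact: nbhs_right_gt.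
have [mn mz] := fn _ (us (h + t)).
apply: (det_tangent_le0 _ _ _ _ _ nn nz mn mz un).
  by apply: quotient_det => //; case: hf => ->; [left|right|left|right].
by apply: hs; rewrite ltrDr.
Unshelve. all: by end_near. Qed.

End Foliation.
End CrookedPlanes.

(** * From the signs to the quadrant *)

Theorem theorem3p4 (R : realType) (u : R -> 'rV[R]_3)
    (u_cont : continuous u)
    (u_spacelike : forall t : R, spacelike (u t))
    (u_ultra : forall s t : R, s <> t -> ultraparallel (u s) (u t)) :
  exists2 e : R, e = 1 \/ e = -1 &
    forall p : R -> 'rV[R]_3,
      regular_curve p -> crooked_foliation p u ->
      forall t : R, quadrant (e *: u t) ((p^`())%classic t).
Proof.
pose g := mdot (u 0) (nminus (u 1)).
have side := same_side_sign _ u_cont u_spacelike u_ultra; rewrite -/g in side.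
have g0 : g != 0 by apply/eqP => g0; have := side _ _ ltr01; rewrite g0 mul0r ltxx.
(* The sign depends on the director path alone and is fixed before [p] is introduced. *)
exists (Num.sg g); first by rewrite /Num.sg (negPf g0); case: ifP; [right|left].
move=> p [_ p0] fol t.
have sideP s : t < s -> 0 < g * mdot (u t) (nplus (u s)).
  move=> ts; have := side _ _ ts.
  have /ultraparallel_same_side : ultraparallel (u t) (u s).
    by apply: u_ultra => e; move: ts; rewrite e ltxx.
  set A := mdot _ _; set B := mdot _ _ => AB gA.
  have A2 : 0 < A ^+ 2.
    by rewrite exprn_even_gt0//=; apply/eqP => A0; rewrite A0 mul0r ltxx in AB.
  (* [A ^+ 2 * (g * B)] is the product of the positive numbers [A * B] and [g * A]. *)
  by rewrite -(pmulr_rgt0 _ A2); have := mulr_gt0 AB gA; nra.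
have [a [b vE]] := det_null_frame _ _ (u_spacelike t) (velocity_perp fol).
(* Pairing the velocity with one null end leaves only the coordinate along the other end, times the
   negative number in [nm]. Hence [g * b <= 0] and [0 <= g * a]. *)
have nm := null_frame_mdot _ (u_spacelike t).
have nn := (nminus_null _ (u_spacelike t)).1.2.
have mm := (nplus_null _ (u_spacelike t)).1.2.
have := velocity_sign fol g _ (or_introl erefl) (fun s => side t s).
rewrite nmulr_lle0 ?mdot_nminus_tangent// vE mdotDl !mdotZl nn mulr0 add0r.
rewrite (mdotC (nplus _)) mulrA nmulr_lge0// => gb.
have := velocity_sign fol g _ (or_intror erefl) sideP.
rewrite pmulr_lle0 ?mdot_nplus_tangent// vE mdotDl !mdotZl mm mulr0 addr0.
rewrite mulrA nmulr_lle0// => ga.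
have v0 : a *: nminus (u t) + b *: nplus (u t) <> 0 by rewrite -vE; exact: p0.
have [gp|gn] := ltP 0 g.
  rewrite gtr0_sg// scale1r; split=> //; exists a, (- b); split.
  - by rewrite -(pmulr_rge0 _ gp).
  - by rewrite oppr_ge0 -(pmulr_rle0 _ gp).
  - by rewrite scaleNr opprK.
have {}gn : g < 0 by rewrite lt_neqAle g0.
(* Negating the director exchanges the null ends, so the quadrant coordinates become [b] and
   [- a]. *)
have [em ep] := null_frameN (u_spacelike t).
rewrite ltr0_sg// scaleN1r; split=> //; exists b, (- a); rewrite em ep; split.
- by rewrite -(nmulr_rle0 _ gn).
- by rewrite oppr_ge0 -(nmulr_rge0 _ gn).
- by rewrite scaleNr opprK addrC.
Qed.
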